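(* Let $q$ be a prime power and $n,k$ integers with $n\geq2k+2$ and $k\geq 4$. Then $$\bar A_q(n,4,k)\geq \sum_{j=1}^{\lfloor\frac{n-2}{k}\rfloor-1}\left(q^{(k-1)(n-jk)}+\frac{(q^{2(k-2)}-1)(q^{2(n-jk-1)}-1)}{(q^4-1)^2}\, q^{(k-3)(n-jk-2)+4}\right)+A^R_q(k\times (n-k), 2, [0,k-4]).$$
   Context: $\mathcal G_q(n,k)$ is the set of $k$-dimensional subspaces of $\mathbb F_q^n$, with subspace distance $d_S(\mathcal U,\mathcal V)=\dim\mathcal U+\dim\mathcal V-2\dim(\mathcal U\cap\mathcal V)$; an $(n,d,k)_q$-CDC is a subset of $\mathcal G_q(n,k)$ with pairwise subspace distance at least $d$. An MRD$[k\times(n-k),\delta]_q$ code is an $\mathbb F_q$-linear subspace of $\mathbb F_q^{k\times(n-k)}$ of dimension $\max\{k,n-k\}(\min\{k,n-k\}-\delta+1)$ whose nonzero elements have rank at least $\delta$; a lifted MRD code is $\{\mathrm{rowspace}(\boldsymbol I_k\mid\boldsymbol A):\boldsymbol A\in\mathcal D\}$ for such $\mathcal D$. $\bar A_q(n,2\delta,k)$ is the maximum size of an $(n,2\delta,k)_q$-CDC containing a lifted MRD code (with the same $\delta$) as a subset. $A^R_q(k\times(n-k),\delta,K)$ is the maximum size of a set of matrices in $\mathbb F_q^{k\times(n-k)}$, each of rank in $K$, with pairwise rank distance at least $\delta$; $[a,b]$ is the set of integers $x$ with $a\le x\le b$. *)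

(* Defs.v *)
From HB Require Import structures.
From mathcomp Require Import all_boot all_order all_algebra.

Set Implicit Arguments.
Unset Strict Implicit.
Unset Printing Implicit Defensive.

Import GRing.Theory VectorInternalTheory.
Local Open Scope ring_scope.

(* Subspaces of a finite-dimensional space over a finite field form a finite
   type, so that set-builder, cardinality and \max range over them. *)
HB.instance Definition _ (F : finFieldType) (vT : vectType F) :=
  [Countable of {vspace vT} by <:].
HB.instance Definition _ (F : finFieldType) (vT : vectType F) :=
  [Finite of {vspace vT} by <:].

Definition subspace_dist (F : finFieldType) (n : nat)
    (U V : {vspace 'rV[F]_n}) : nat :=
  (\dim U + \dim V - 2 * \dim (U :&: V))%N.

(* (n, d, k)_q constant dimension codes, with q = #|F|. *)
Definition is_cdc (F : finFieldType) (n d k : nat)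
    (C : {set {vspace 'rV[F]_n}}) : bool :=
  [forall U in C, \dim U == k] &&
  [forall U in C, forall V in C, (U != V) ==> (d <= subspace_dist U V)%N].

Definition is_MRD (F : finFieldType) (k m delta : nat)
    (D : {vspace 'M[F]_(k, m)}) : bool :=
  (\dim D == maxn k m * (minn k m + 1 - delta))%N &&
  [forall A in D, (A != 0) ==> (delta <= \rank A)%N].

Definition rowspace (F : finFieldType) (k n : nat) (M : 'M[F]_(k, n)) :
    {vspace 'rV[F]_n} :=
  <<[seq row i M | i <- enum 'I_k]>>%VS.

(* rowspace (I_k | A); for k <= n, conform_mx is just the cast along
   k + (n - k) = n (the default value 0 is only used when n < k). *)
Definition lift_matrix (F : finFieldType) (n k : nat)
    (A : 'M[F]_(k, n - k)) : {vspace 'rV[F]_n} :=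
  rowspace (conform_mx (0 : 'M[F]_(k, n)) (row_mx 1%:M A)).

Definition lifted_code (F : finFieldType) (n k : nat)
    (D : {vspace 'M[F]_(k, n - k)}) : {set {vspace 'rV[F]_n}} :=
  [set lift_matrix A | A in D].

Definition contains_lifted_MRD (F : finFieldType) (n k delta : nat)
    (C : {set {vspace 'rV[F]_n}}) : bool :=
  [exists D : {vspace 'M[F]_(k, n - k)},
     is_MRD delta D && (lifted_code D \subset C)].

(* \bar A_q(n, 2 delta, k), with q = #|F|. *)
Definition Abar (F : finFieldType) (n delta k : nat) : nat :=
  \max_(C : {set {vspace 'rV[F]_n}} |
         is_cdc (2 * delta) k C && contains_lifted_MRD k delta C) #|C|.

Definition rank_dist (F : finFieldType) (k m : nat) (A B : 'M[F]_(k, m)) : nat :=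
  \rank (A - B).

(* A^R_q(k x m, delta, K), with q = #|F|. *)
Definition AR (F : finFieldType) (k m delta : nat) (K : {pred nat}) : nat :=
  \max_(C : {set 'M[F]_(k, m)} |
         [forall A in C, \rank A \in K] &&
         [forall A in C, forall B in C,
            (A != B) ==> (delta <= rank_dist A B)%N]) #|C|.

(* Main.v *)
(* With m = n - jk and o = (j-1)k, the j-th summand counts two kinds of echelon
   matrices whose pivots lie in the columns from o on: those with pivots
   o, ..., o+k-1, and those which skip two adjacent columns of that block and
   take two adjacent pivots further to the right.  The free entries of a fixed
   pivot pattern range over a linear code of minimum rank 2, cut out of all
   fillings by the single equation sum_ic A_ic alpha_i beta_c = 0 in F_{q^m},
   with (alpha_i) and (beta_c) linearly independent over F_q: a rank one
   solution would factor as a product of two nonzero elements.  So only m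
   dimensions are lost.  A nonzero vector common to two row spaces starts at a
   common pivot, which gives distance 4 as soon as each pattern has two pivots
   outside the other.  The matrices (A | I) with rank A <= k-4 are added in
   parallel: vectors of their row space vanishing in the first n-k columns form a
   subspace of dimension >= 4, and meet each earlier codeword in dimension <= 2,
   since it has at most two pivots among the last k columns. *)

Require Import Defs.
From HB Require Import structures.
From mathcomp Require Import all_boot all_order all_fingroup all_algebra.
From mathcomp Require Import all_solvable all_field.
From mathcomp Require Import zify ring.

Set Implicit Arguments.
Unset Strict Implicit.
Unset Printing Implicit Defensive.

Import Order.TTheory GRing.Theory Num.Theory.
Local Open Scope ring_scope.

(** * Finite extension fields *)

(** Take the splitting field of X^Q - X with Q = q^m. Its roots are distinct and form the fixed
    field of the m-th power of Frobenius, so they exhaust the field, which then has Q elements. *)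
Lemma finField_extension (F : finFieldType) (m : nat) :
  (0 < m)%N -> exists L : fieldExtType F, \dim {:L} = m.
Proof.
move=> m_gt0; set Q := (#|F| ^ m)%N.
have Q_gt1 : (1 < Q)%N by rewrite -(exp1n m) ltn_exp2r // finNzRing_gt1.
have szP (R : nzRingType) : size ('X^Q - 'X : {poly R}) = Q.+1.
  by rewrite size_polyDl size_polyXn // size_polyN size_polyX.
have P_neq0 : 'X^Q - 'X != 0 :> {poly F} by rewrite -size_poly_eq0 szP.
have [L [zs Pzs genL]] := FinSplittingFieldFor P_neq0.
rewrite rmorphB rmorphXn /= map_polyX in Pzs.
exists L.
have Q0 : Q%:R = 0 :> L.
  have q0 : #|F|%:R = 0 :> F.
    by have := expg_cardG (in_setT (1 : F)); rewrite cardsT.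
  by rewrite /Q -(prednK m_gt0) expnS natrM -(rmorph_nat (in_alg L)) q0 rmorph0 mul0r.
(* Since Q = 0 in [L], the derivative of X^Q - X is -1, hence coprime to it. *)
have Uzs : uniq zs.
  rewrite -separable_prod_XsubC -(eqp_separable Pzs) separable_poly.unlock.
  rewrite derivB derivXn derivX -mulr_natl.
  have -> : Q%:R = 0 :> {poly L} by rewrite -polyC_natr Q0.
  by rewrite mul0r sub0r -[X in coprimep _ X]scaleN1r coprimepZr ?coprimep1 // oppr_eq0 oner_eq0.
have /finField_galois_generator[/= a _ Da] : (1 <= {:L})%VS by apply: sub1v.
(* The generator [a] is the map z -> z^q, so [E] consists of the solutions of z^Q = z. *)
pose E := fixedSpace (a ^+ m)%g.
have zsE : zs =i E.
  move=> z; rewrite -root_prod_XsubC -(eqp_root Pzs) (sameP fixedSpaceP eqP).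
  rewrite /root !hornerE subr_eq0 /= /Q; congr (_ == z).
  elim: (m) => [|i IHi]; first by rewrite gal_id.
  rewrite expgSr expnSr exprM IHi galM ?Da ?memvf //.
  by rewrite dimv1 expn1.
have Efull : E = {:L}%VS.
  apply/eqP; rewrite eqEsubv subvf -genL -[E]subfield_closed agenvS //.
  by rewrite subv_add sub1v; apply/span_subvP => z; rewrite zsE.
have cardL : #|{: finvect_type L}%VS| = Q.
  have /eq_card -> : {: finvect_type L}%VS =i (zs : seq (finvect_type L)).
    by move=> z; rewrite memvf; have := zsE z; rewrite Efull memvf.
  apply: succn_inj; rewrite (card_uniqP _) // -(szP L) (eqp_size Pzs).
  by rewrite size_prod_XsubC.
have := cardL; rewrite card_vspace => /eqP.
by rewrite eqn_exp2l ?finNzRing_gt1 // => /eqP.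
Qed.

(** * Linear matrix codes of minimum rank two with prescribed support *)

Section RankTwo.
Variables (F : finFieldType).

(** Only the size of [E] is bounded by the degree, so independence is stated for coefficients
    supported on [E]. Indexing [b] by all of [T] lets later sums run over every column. *)
Lemma exists_indep (L : fieldExtType F) (T : finType) (E : {set T}) :
  (#|E| <= \dim {:L})%N ->
  exists b : T -> L, forall y : T -> F, (forall c, c \notin E -> y c = 0) ->
    \sum_c y c *: b c = 0 -> forall c, y c = 0.
Proof.
move=> leE; set X := vbasis {:L}; have freeX : free X := basis_free (vbasisP _).
exists (fun c => X`_(index c (enum E))) => y yE sum0 c.
have [cE|/yE //] := boolP (c \in E).
have idx d : d \in E -> (index d (enum E) < \dim {:L})%N.
  by move=> dE; apply: leq_trans leE; rewrite cardE index_mem mem_enum.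
have coordX d (dE : d \in E) :
    coord X (Ordinal (idx c cE)) X`_(index d (enum E)) = (index d (enum E) == index c (enum E))%:R.
  rewrite (_ : X`_(index d (enum E)) = X`_(Ordinal (idx d dE))) //.
  by rewrite coord_free // -val_eqE /= eq_sym.
have /(congr1 (coord X (Ordinal (idx c cE)))) := sum0.
rewrite linear_sum linear0 (bigD1 c) //= linearZ /= coordX // eqxx mulr1.
rewrite big1 ?addr0 // => d dc; rewrite linearZ /=.
have [dE|/yE ->] := boolP (d \in E); last by rewrite mul0r.
rewrite coordX //; case: eqP => [e|]; last by rewrite mulr0.
case/eqP: dc; apply/esym.
by rewrite -[LHS](@nth_index _ c _ (enum E)) ?mem_enum // -e nth_index ?mem_enum.
Qed.

Lemma exists_subspace_dim (vT : vectType F) (U : {vspace vT}) (d : nat) :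
  (d <= \dim U)%N -> exists2 V : {vspace vT}, (V <= U)%VS & \dim V = d.
Proof.
move=> led; exists <<take d (vbasis U)>>%VS.
  by apply/span_subvP => v /mem_take /vbasis_mem.
have: free (take d (vbasis U)).
  by apply: (@catl_free _ _ (drop d (vbasis U))); rewrite cat_take_drop (basis_free (vbasisP _)).
by rewrite /free => /eqP ->; rewrite size_takel // size_tuple.
Qed.

(** The set [E] contains the columns that meet [P]; asking for independence only there allows the
    width [w] to exceed [m]. *)
Lemma rank_ge2_space (k w m : nat) (P : {set 'I_k * 'I_w}) (E : {set 'I_w}) :
  (0 < m)%N -> (k <= m)%N -> (#|E| <= m)%N ->
  (forall x, x \in P -> x.2 \in E) ->
  exists D : {vspace 'M[F]_(k, w)}, \dim D = (#|P| - m)%N /\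
   forall A, A \in D -> (forall i c, (i, c) \notin P -> A i c = 0) /\
     (A != 0 -> (2 <= \rank A)%N).
Proof.
move=> m_gt0 km Em PE; have [L dimL] := finField_extension F m_gt0.
have [al alP] : exists al : 'I_k -> L, forall x : 'I_k -> F,
    \sum_i x i *: al i = 0 -> forall i, x i = 0.
  have [|b bP] := @exists_indep L _ [set: 'I_k]; first by rewrite cardsT card_ord dimL.
  by exists b => x; apply: bP => c; rewrite inE.
have [|be beP] := @exists_indep L _ E; first by rewrite dimL.
(* [psi] writes the coordinates of [v] into the cells of [P], and [phi] below is the left side of
   the defining equation in [L]. *)
pose psi (v : 'rV[F]_#|P|) : 'M[F]_(k, w) :=
  \sum_p v 0 p *: delta_mx (enum_val p).1 (enum_val p).2.
have psi_lin : linear psi.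
  move=> a u v; rewrite /psi scaler_sumr -big_split; apply: eq_bigr => p _.
  by rewrite !mxE scalerDl scalerA.
pose phi (A : 'M[F]_(k, w)) : L := \sum_i \sum_c A i c *: (al i * be c).
have phi_lin : linear phi.
  move=> a A B; rewrite /phi scaler_sumr -big_split; apply: eq_bigr => i _.
  rewrite scaler_sumr -big_split; apply: eq_bigr => c _.
  by rewrite !mxE scalerDl scalerA.
pose psiL : {linear 'rV[F]_#|P| -> 'M[F]_(k, w)} :=
  HB.pack psi (GRing.isLinear.Build _ _ _ _ psi psi_lin).
pose phiL : {linear 'M[F]_(k, w) -> L} :=
  HB.pack phi (GRing.isLinear.Build _ _ _ _ phi phi_lin).
pose Psi := linfun psiL; pose Phi := linfun phiL.
have psiE v p : psi v (enum_val p).1 (enum_val p).2 = v 0 p.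
  rewrite /psi summxE (bigD1 p) //= !mxE !eqxx mulr1 big1 ?addr0 // => r rp.
  rewrite !mxE; case: andP => [[/eqP e1 /eqP e2]|]; last by rewrite mulr0.
  case/eqP: rp; apply/enum_val_inj.
  by rewrite [LHS]surjective_pairing [RHS]surjective_pairing e1 e2.
have Psi_inj : lker Psi == 0%VS.
  apply/lker0P => u v; rewrite !lfunE /= => e; apply/rowP => p.
  by rewrite -!psiE e.
pose K := lker (Phi \o Psi)%VF.
(* The solutions have dimension at least [#|P| - m]. Cutting down to equality yields the exact
   dimension required of an MRD code. *)
have [|D DK dimD] := @exists_subspace_dim _ (Psi @: K)%VS (#|P| - m).
  rewrite limg_dim_eq; last by rewrite (eqP Psi_inj) capv0.
  have := limg_ker_dim (Phi \o Psi)%VF fullv; rewrite capfv -/K dimvf /= /dim /= mul1n => e.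
  rewrite leq_subLR -[X in (X <= _)%N]e addnC leq_add2r -dimL dimvS //; exact: subvf.
exists D; split=> // A /(subvP DK) /memv_imgP[v]; rewrite memv_ker => /eqP.
rewrite lfunE /= !lfunE /= => phi0 eA; rewrite -eA in phi0.
have AP i c : (i, c) \notin P -> A i c = 0.
  move=> ic; rewrite eA /psi summxE big1 // => p _; rewrite !mxE.
  case: andP => [[/eqP e1 /eqP e2]|]; last by rewrite mulr0.
  by case/negP: ic; rewrite e1 e2 -surjective_pairing enum_valP.
split=> // A0; rewrite ltnNge; apply/negP => rA.
have {}rA : \rank A = 1%N by apply/eqP; rewrite eqn_leq rA lt0n mxrank_eq0.
have [x [y xy]] : exists x : 'I_k -> F, exists y : 'I_w -> F, forall i c, A i c = x i * y c.
  have := mulmx_base A; move: (col_base A) (row_base A); rewrite rA => X Y XY.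
  exists (X^~ 0), (Y 0) => i c; by rewrite -XY !mxE big_ord1.
have mul_sums (X : 'I_k -> L) (Y : 'I_w -> L) :
    (\sum_i X i) * (\sum_c Y c) = \sum_i \sum_c X i * Y c.
  by rewrite mulr_suml; apply: eq_bigr => i _; rewrite mulr_sumr.
have prod0 : (\sum_i x i *: al i : L) * (\sum_c y c *: be c : L) = 0.
  transitivity (phi A); last exact: phi0.
  have := mul_sums (fun i => x i *: al i) (fun c => y c *: be c) => /=.
  move=> e; apply: (etrans e); apply: eq_bigr => i _; apply: eq_bigr => c _.
  by rewrite -scalerAl -scalerAr scalerA xy.
case/eqP: A0; apply/matrixP => i c; rewrite mxE.
move/eqP: prod0; rewrite mulf_eq0 => /orP[] /eqP; first by move/alP => x0; rewrite xy x0 mul0r.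
(* If [x i] is nonzero, then [y] vanishes outside [E] because row [i] of [A] does, and the
   independence of [be] on [E] applies. *)
have [/eqP xi0|xi0] := boolP (x i == 0); first by rewrite xy xi0 mul0r.
move=> sum0; rewrite xy (beP y) ?mulr0 // => d dE.
apply/(mulfI xi0); rewrite -xy mulr0 AP //; by apply: contra dE => /PE.
Qed.
End RankTwo.

(** * Row spaces, pivots and dimensions of intersections *)

Section Rowspace.
Variables (F : finFieldType) (n : nat).
Implicit Types (X : {vspace 'rV[F]_n}) (S : {set 'I_n}).

Lemma rowspaceP k (M : 'M[F]_(k, n)) (u : 'rV[F]_n) :
  reflect (exists x, u = x *m M) (u \in rowspace M).
Proof.
apply: (iffP idP) => [|[x ->]].
  rewrite /rowspace => /coord_span ->; elim/big_ind: _ => [|v1 v2 [x ->] [y ->]|i _].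
  - by exists 0; rewrite mul0mx.
  - by exists (x + y); rewrite mulmxDl.
  - have : [seq row j M | j <- enum 'I_k]`_i \in [seq row j M | j <- enum 'I_k].
      by apply: mem_nth; rewrite size_map -cardE.
    case/mapP => j _ ->; eexists (_ *: delta_mx 0 j).
    by rewrite -scalemxAl -rowE.
rewrite mulmx_sum_row; apply: rpred_sum => i _; apply: rpredZ; apply: memv_span.
by apply/mapP; exists i => //; rewrite mem_enum.
Qed.

Lemma dim_le_param X r (B : 'M[F]_(r, n)) :
  (forall u, u \in X -> exists y, u = y *m B) -> (\dim X <= r)%N.
Proof.
move=> XB; have : (X <= limg (linfun (mulmxr B : 'rV_r -> _)))%VS.
  by apply/subvP => u /XB[y ->]; rewrite -[y *m B](lfunE (mulmxr B)) memv_img ?memvf.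
move=> /dimvS /leq_trans -> //.
have := limg_ker_dim (linfun (mulmxr B : 'rV_r -> _)) fullv.
by rewrite dimvf /dim /= mul1n => e; rewrite -[leqRHS]e leq_addl.
Qed.

(** Projection to the coordinates in [S] is injective on [X]. Intersections of codewords with
    different pivots are bounded through such test sets. *)
Lemma dim_le_coords X S :
  (forall u, u \in X -> (forall c, c \in S -> u 0 c = 0) -> u = 0) ->
  (\dim X <= #|S|)%N.
Proof.
move=> XS; pose g := linfun (fun u : 'rV[F]_n => colsub (enum_val : 'I_#|S| -> _) u).
have X0 : (X :&: lker g = 0)%VS.
  apply/eqP; rewrite -subv0; apply/subvP => u /memv_capP[uX].
  rewrite memv_ker lfunE memv0 /= => /eqP/rowP e; apply/eqP/XS => // c cS.
  by have := e (enum_rank_in cS c); rewrite !mxE enum_rankK_in.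
by rewrite -(limg_dim_eq X0) (leq_trans (dimvS (subvf _))) // dimvf /dim /= mul1n.
Qed.

(** Kept apart from [echelon]: a matrix (A | I) is pivoted on its last columns, while its entries to
    the left of them are arbitrary. *)
Definition pivoted k (p : 'I_k -> 'I_n) (M : 'M[F]_(k, n)) :=
  forall i l, M i (p l) = (i == l)%:R.

Definition echelon k (p : 'I_k -> 'I_n) (M : 'M[F]_(k, n)) :=
  pivoted p M /\ forall i (c : 'I_n), (c < p i)%N -> M i c = 0.

Lemma pivoted_coord k p (M : 'M[F]_(k, n)) (x : 'rV_k) l :
  pivoted p M -> (x *m M) 0 (p l) = x 0 l.
Proof.
move=> pM; rewrite mxE (bigD1 l) //= pM eqxx mulr1 big1 ?addr0 // => i il.
by rewrite pM (negPf il) mulr0.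
Qed.

Lemma dim_rowspace k p (M : 'M[F]_(k, n)) : pivoted p M -> \dim (rowspace M) = k.
Proof.
move=> pM; have -> : rowspace M = limg (linfun (mulmxr M : 'rV_k -> _)).
  apply/vspaceP => u; apply/rowspaceP/memv_imgP => [[x ->]|[x _ ->]].
    by exists x; rewrite ?memvf ?lfunE.
  by exists x; rewrite lfunE.
rewrite limg_dim_eq ?dimvf /dim /= ?mul1n //; apply/eqP; rewrite -subv0.
apply/subvP => x /memv_capP[_]; rewrite memv_ker lfunE memv0 /= => /eqP e.
by apply/eqP/rowP => l; rewrite -(pivoted_coord _ _ pM) e !mxE.
Qed.

(** Reading a common vector at the shared pivots shows that it has the same coefficients [x] over
    [M] and [N], so [x] lies in the kernel of [M - N]. *)
Lemma dim_cap_same_pivots k p (M N : 'M[F]_(k, n)) :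
  pivoted p M -> pivoted p N ->
  (\dim (rowspace M :&: rowspace N) <= k - \rank (M - N)%R)%N.
Proof.
move=> pM pN; rewrite -mxrank_ker.
apply: (@dim_le_param _ _ (row_base (kermx (M - N)) *m M)).
move=> u /memv_capP[/rowspaceP[x ->] /rowspaceP[y xy]].
have {xy} xMN : x *m M = x *m N.
  rewrite xy; congr (_ *m _); apply/rowP => l.
  by rewrite -(pivoted_coord _ _ pN) -xy (pivoted_coord _ _ pM).
have : (x <= row_base (kermx (M - N)))%MS.
  by rewrite eq_row_base; apply/sub_kermxP; rewrite mulmxBr xMN subrr.
by case/submxP => y' ->; exists y'; rewrite -[LHS]mulmxA.
Qed.

(** Coefficients of rows with pivot before [c] are read off at the pivots and vanish; rows with
    pivot after [c] are zero in column [c]. If [c] were no pivot, nothing would remain. *)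
Lemma echelon_lead k p (M : 'M[F]_(k, n)) u (c : 'I_n) :
  echelon p M -> u \in rowspace M ->
  (forall d : 'I_n, (d < c)%N -> u 0 d = 0) -> u 0 c != 0 -> exists i, p i = c.
Proof.
move=> [pM eM] /rowspaceP[x ->] lead; have [/existsP[i /eqP <-]|] := boolP [exists i, p i == c].
  by exists i.
rewrite negb_exists => /forallP pc; rewrite mxE big1 ?eqxx // => i _.
have [lt|gt|/val_inj e] := ltngtP (p i) c.
- by rewrite -(pivoted_coord _ _ pM) lead ?mul0r.
- by rewrite eM ?mulr0.
- by have := pc i; rewrite e eqxx.
Qed.

Lemma leading_coord (u : 'rV[F]_n) : u != 0 ->
  exists2 c, u 0 c != 0 & forall d : 'I_n, (d < c)%N -> u 0 d = 0.
Proof.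
move=> u0; have [c0 c0P] : exists c, u 0 c != 0.
  apply/existsP; apply: contraNT u0; rewrite negb_exists => /forallP e.
  by apply/eqP/rowP => c; rewrite mxE; apply/eqP; rewrite -[_ == _]negbK e.
case: (@arg_minnP _ c0 (fun c => u 0 c != 0) val c0P) => c cP cmin; exists c => // d dc.
by apply/eqP; apply: contraTT dc => /cmin; rewrite -leqNgt.
Qed.

(** The leading position of a nonzero common vector is a pivot of both matrices, so it is neither
    [p i1] nor [p i2]. A common vector vanishing at the other pivots of [M] is therefore zero. *)
Lemma dim_cap_echelon k p q (M N : 'M[F]_(k, n)) i1 i2 :
  echelon p M -> echelon q N -> i1 != i2 ->
  (forall i, q i != p i1) -> (forall i, q i != p i2) ->
  (\dim (rowspace M :&: rowspace N) <= k - 2)%N.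
Proof.
move=> eM eN i12 q1 q2; pose S := p @: ~: [set i1; i2].
have cS : (#|S| <= k - 2)%N.
  apply: leq_trans (leq_imset_card _ _) _.
  by rewrite cardsCs setCK card_ord cards2 i12.
apply: leq_trans cS; apply: dim_le_coords => u /memv_capP[uM uN] uS; apply/eqP.
apply/negPn/negP => /leading_coord[c uc lead].
have [i pi] := echelon_lead eM uM lead uc; have [l ql] := echelon_lead eN uN lead uc.
case/negP: uc; rewrite uS // -pi; apply: imset_f; rewrite !inE.
by apply/norP; split; apply/eqP => e; [have := q1 l | have := q2 l]; rewrite ql -pi e eqxx.
Qed.

End Rowspace.

(** The test set consists of [\rank A] columns spanning the column space of [A], which detect
    [x *m A], and of the pivots of [M] among the last [k] columns, where a remaining vector must
    start. *)
Lemma dim_cap_echelon_right (F : finFieldType) n k m (e : (m + k = n)%N)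
    (p : 'I_k -> 'I_n) (M : 'M[F]_(k, n)) (A : 'M[F]_(k, m)) s :
  echelon p M -> (#|[set i | m <= p i]| <= s)%N ->
  (\dim (rowspace M :&: rowspace (castmx (erefl k, e) (row_mx A 1%:M)))
    <= \rank A + s)%N.
Proof.
move=> eM ps; case: n / e p M eM ps => p M eM ps; rewrite castmx_id.
(* A vector (x A, x) vanishing on T has x A = 0. *)
pose T := lshift k @: (maxrankfun A^T @: [set: 'I_(\rank A^T)]).
pose S := T :|: p @: [set i | m <= p i]%N.
have cS : (#|S| <= \rank A + s)%N.
  apply: leq_trans (leq_card_setU _ _) _; apply: leq_add.
    apply: leq_trans (leq_imset_card _ _) _; apply: leq_trans (leq_imset_card _ _) _.
    by rewrite cardsT card_ord mxrank_tr.
  exact: leq_trans (leq_imset_card _ _) ps.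
apply: leq_trans cS; apply: dim_le_coords => u /memv_capP[uM /rowspaceP[x ux]] uS.
have xA : x *m A = 0.
  have : rowsub (maxrankfun A^T) A^T *m x^T = 0.
    apply/colP => i; rewrite mxE [RHS]mxE.
    have := uS (lshift k (maxrankfun A^T i)); rewrite ux mul_mx_row row_mxEl.
    rewrite inE !imset_f ?inE // => /(_ isT) xA0; rewrite -[RHS]xA0 mxE.
    by apply: eq_bigr => l _; rewrite !mxE mulrC.
  have /submxP[B defA] : (A^T <= rowsub (maxrankfun A^T) A^T)%MS by rewrite eq_maxrowsub.
  by move=> R0; apply: trmx_inj; rewrite trmx_mul {1}defA -mulmxA R0 mulmx0 trmx0.
apply/eqP/negPn/negP => /leading_coord[c uc lead].
have [i pi] := echelon_lead eM uM lead uc.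
have mc : (m <= c)%N.
  rewrite leqNgt; apply/negP => cm; case/negP: uc.
  rewrite ux mul_mx_row xA (_ : c = lshift k (Ordinal cm)); last exact/val_inj.
  by rewrite row_mxEl mxE.
case/negP: uc; rewrite uS // inE -pi; apply/orP; right; apply: imset_f; by rewrite inE pi.
Qed.

(** * Codes of echelon matrices with a fixed pivot pattern *)

Lemma card_ord_geq (n a : nat) : #|[set c : 'I_n | (a <= c)%N]| = (n - a)%N.
Proof.
have := sum_nat_const_nat a n 1; rewrite muln1 => <-; rewrite big_geq_mkord -sum1_card.
by apply: eq_bigl => c; rewrite inE.
Qed.

Section EchelonCode.
Variables (F : finFieldType) (n k : nat) (p : 'I_k -> 'I_n).
Hypothesis p_mono : {homo p : i l / (i < l)%N}.

(** The Ferrers diagram of the pivots: the free cells of a reduced row echelon form. *)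
Definition dots : {set 'I_k * 'I_n} :=
  [set x : 'I_k * 'I_n | (p x.1 < x.2)%N && (x.2 \notin codom p)].

Let p_inj : injective p.
Proof.
move=> i l e; apply/val_inj; case: (ltngtP i l) => // /p_mono; by rewrite e ltnn.
Qed.

(** In row [i], [n - 1 - p i] columns lie to the right of the pivot, and at most [k - 1 - i] of them
    are pivot columns. *)
Lemma dots_geq : (\sum_(i < k) (n - k + i - p i) <= #|dots|)%N.
Proof.
rewrite -sum1_card.
rewrite (eq_bigl (fun x : 'I_k * 'I_n =>
  true && ((p x.1 < x.2)%N && (x.2 \notin codom p)))); last by move=> x; rewrite inE.
rewrite -(pair_big_dep xpredT
  (fun (i : 'I_k) (c : 'I_n) => (p i < c)%N && (c \notin codom p)) (fun _ _ => 1%N)) /=.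
apply: leq_sum => i _; rewrite sum1_card.
have sub : [set c : 'I_n | (p i).+1 <= c]%N :\: p @: [set l : 'I_k | i.+1 <= l]%N \subset
   [pred c : 'I_n | (p i < c)%N && (c \notin codom p)].
  apply/subsetP => c; rewrite !inE => /andP[cp pic]; rewrite pic /=.
  apply: contra cp => /codomP[l cl]; rewrite cl imset_f // inE ltnNge.
  apply: contraTN pic; rewrite cl -leqNgt leq_eqVlt => /orP[/eqP/val_inj -> //|/p_mono /ltnW //].
apply: leq_trans (subset_leq_card sub).
rewrite cardsD card_ord_geq (leq_trans _ (leq_sub2l _ (subset_leq_card (subsetIr _ _)))) //.
have := leq_card p p_inj; rewrite card_imset // card_ord_geq !card_ord; have := ltn_ord i; lia.
Qed.

(** All dots lie in the [n - o - k] non-pivot columns from [o] on, so an extension of that degree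
    suffices. Translating the linear code by the bare pivot matrix [M0] preserves differences. *)
Lemma echelon_code (o : nat) :
  (forall i, (o <= p i)%N) -> (0 < k)%N -> (k <= n - o - k)%N ->
  exists C : {set 'M[F]_(k, n)}, [/\ #|C| = (#|F| ^ (#|dots| - (n - o - k)))%N,
    forall M, M \in C -> echelon p M &
    forall M N, M \in C -> N \in C -> M != N -> (2 <= \rank (M - N)%R)%N].
Proof.
move=> op k0 km; pose E := [set c : 'I_n | o <= c]%N :\: p @: [set: 'I_k].
have cE : (#|E| <= n - o - k)%N.
  rewrite cardsD card_ord_geq (setIidPr _) ?card_imset ?cardsT ?card_ord //.
  by apply/subsetP => c /imsetP[i _ ->]; rewrite inE.
have [||D [dimD DP]] := @rank_ge2_space F k n (n - o - k) dots E _ km cE.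
- exact: leq_trans km.
- case=> i c; rewrite !inE /= => /andP[pic /codomP cp]; rewrite (leq_trans (op i) (ltnW pic)) andbT.
  by apply/imsetP => -[l _ cl]; apply: cp; exists l.
pose M0 : 'M[F]_(k, n) := \matrix_(i, c) (c == p i)%:R.
have addI : injective (+%R M0) := addrI M0.
exists [set M0 + A | A in D]; split.
- by rewrite card_imset // card_vspace dimD.
- move=> _ /imsetP[A AD ->]; have [A0 _] := DP A AD; split=> [i l|i c ci]; rewrite !mxE.
    rewrite A0 ?addr0 ?(inj_eq p_inj) ?[l == i]eq_sym // !inE /=.
    by rewrite codom_f andbF.
  rewrite A0 ?addr0; last by rewrite inE /= ltnNge (ltnW ci).
  by rewrite -val_eqE ltn_eqF.
- move=> _ _ /imsetP[A AD ->] /imsetP[B BD ->]; rewrite (inj_eq addI) => AB.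
  rewrite opprD addrACA subrr add0r; apply: (DP _ _).2; first exact: memvB.
  by rewrite subr_eq0.
Qed.
End EchelonCode.

(* Pivots of the blocks: consecutive from [o] on, or skipping the two columns
   [o + u, o + u + 1] with [u = k - 2 - 2 x] and ending with the two columns
   [o + k + 2 y, o + k + 2 y + 1] beyond the block.  Counting the gap from the
   right end of its block makes one exponent formula serve both parities. *)
Definition pivot (k o : nat) (g : option (nat * nat)) (i : nat) : nat :=
  if g is Some (x, y) then
    if (i < k - 2 - 2 * x)%N then (o + i)%N
    else if (i < k - 2)%N then (o + i + 2)%N
    else (o + k + 2 * y + (i - (k - 2)))%N
  else (o + i)%N.

(** The bound on [x] makes the gap start at u >= 1, and the bound on [y] keeps the last two pivots
    inside the matrix. Under both, the truncated subtractions in [pivot] and [code_exponent] are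
    exact. *)
Definition valid_shape (k m : nat) (g : option (nat * nat)) : bool :=
  if g is Some (x, y) then (x < (k - 1) %/ 2)%N && (y < m %/ 2)%N else true.

(* The number of free entries of the pattern, minus [m]. *)
Definition code_exponent (k m : nat) (g : option (nat * nat)) : nat :=
  if g is Some (x, y) then
    ((k - 3) * (m - 2) + (2 * (k - 3) - 4 * x) + (2 * (m - 2) - 4 * y))%N
  else ((k - 1) * m)%N.

(** * Counting free cells and separating pivot patterns *)

Section Pivots.
Variables (n k : nat).
Hypothesis hk : (4 <= k)%N.

Lemma pivot_ltn o g i l : valid_shape k (n - o - k) g -> (i < l < k)%N ->
  (pivot k o g i < pivot k o g l)%N.
Proof.
case: g => [[x y]|] /=; last by lia.
move=> /andP[hx hy] il; repeat case: ifP; lia.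
Qed.

Lemma pivot_lt o g i : (o + k <= n)%N -> valid_shape k (n - o - k) g -> (i < k)%N ->
  (o <= pivot k o g i < n)%N.
Proof.
move=> okn; case: g => [[x y]|] /=; last by lia.
move=> /andP[hx hy] il; repeat case: ifP; lia.
Qed.

Lemma sum_pivot o g : (o + k + k <= n)%N -> valid_shape k (n - o - k) g ->
  (code_exponent k (n - o - k) g + (n - o - k) <= \sum_(i < k) (n - k + i - pivot k o g i))%N.
Proof.
move=> okn; set m := (n - o - k)%N; have mE : n = (m + o + k)%N by lia.
rewrite -(big_mkord xpredT (fun i => n - k + i - pivot k o g i)%N).
have const a b c f : (forall i, (a <= i < b)%N -> f i = c) ->
    (\sum_(a <= i < b) f i = (b - a) * c)%N.
  by move=> fc; rewrite (eq_big_nat _ _ fc) sum_nat_const_nat.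
case: g => [[x y]|] /= => [/andP[hx hy]|_]; last first.
  rewrite (const _ _ m) ?subn0; first by nia.
  by move=> i ik; lia.
rewrite (@big_cat_nat _ _ _ (k - 2 - 2 * x)) //=; last by lia.
rewrite (@big_cat_nat _ _ _ (k - 2) (k - 2 - 2 * x)) //=; [|lia|lia].
rewrite (const _ _ m); last by move=> i ik; case: ifP; lia.
rewrite (const _ _ (m - 2)%N); last by move=> i ik; repeat case: ifP; lia.
rewrite (const _ _ (m - 2 - 2 * y)%N); last by move=> i ik; repeat case: ifP; lia.
(* Substituting [k'] and [m'] removes all subtractions, leaving a polynomial identity. *)
have [k' kE] : exists k', k = (k' + 3 + 2 * x)%N by exists (k - 3 - 2 * x)%N; lia.
have [m' mE'] : exists m', m = (m' + 2 + 2 * y)%N by exists (m - 2 - 2 * y)%N; lia.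
rewrite mE' kE.
have -> : (k' + 3 + 2 * x - 2 - 2 * x - 0 = k' + 1)%N by lia.
have -> : (k' + 3 + 2 * x - 2 - (k' + 3 + 2 * x - 2 - 2 * x) = 2 * x)%N by lia.
have -> : (k' + 3 + 2 * x - (k' + 3 + 2 * x - 2) = 2)%N by lia.
have -> : (m' + 2 + 2 * y - 2 - 2 * y = m')%N by lia.
have -> : (m' + 2 + 2 * y - 2 = m' + 2 * y)%N by lia.
have -> : (k' + 3 + 2 * x - 3 = k' + 2 * x)%N by lia.
nia.
Qed.

(** One-sided, since two pivots of one pattern missing from the other already bound the
    intersection, and that bound is symmetric. *)
Definition separated (p q : nat -> nat) : Prop :=
  exists i1 i2, [/\ (i1 < i2 < k)%N, forall i, (i < k)%N -> q i <> p i1 &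
    forall i, (i < k)%N -> q i <> p i2].

(** The first two pivots of the earlier block lie before column [o + k], whatever its shape, and the
    later pivots start at [o']. *)
Lemma pivot_separated_block o o' m g g' : (o + k <= o')%N ->
  valid_shape k m g -> separated (pivot k o g) (pivot k o' g').
Proof.
move=> oo' vg; exists 0, 1; split; first by lia.
- move=> i ik; case: g vg => [[x y]|]; case: g' => [[x' y']|] //= vg; repeat case: ifP; lia.
- move=> i ik; case: g vg => [[x y]|]; case: g' => [[x' y']|] //= vg; repeat case: ifP; lia.
Qed.

(** With different gaps, the two columns skipped by one pattern are pivots of the other; with equal
    gaps, the final pivot pairs are disjoint. *)
Lemma pivot_separated_shape o m m' g g' : valid_shape k m g -> valid_shape k m' g' ->
  g <> g' -> separated (pivot k o g) (pivot k o g') \/ separated (pivot k o g') (pivot k o g).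
Proof.
have full x y m1 : valid_shape k m1 (Some (x, y)) -> 
   separated (pivot k o None) (pivot k o (Some (x, y))).
  move=> /= /andP[hx _]; exists (k - 2 - 2 * x)%N, (k - 2 - 2 * x).+1.
  by split; [lia | move=> i ik /=; repeat case: ifP; lia..].
case: g => [[x y]|]; case: g' => [[x' y']|] //; last first.
- by move=> _ v _; left; apply: full v.
- by move=> v _ _; right; apply: full v.
move=> v v' gg'; left.
have [exx|xx] := eqVneq x x'.
  have yy : y <> y' by move=> e; apply: gg'; rewrite exx e.
  move: v v' => /= /andP[hx _] /andP[hx' _]; subst x'.
  exists (k - 2)%N, (k - 1)%N.
  by split; [lia | move=> i ik /=; repeat case: ifP; lia..].
move: v v' => /= /andP[hx _] /andP[hx' _].
have [lt|ge] := ltnP x x'.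
  exists (k - 2 - 2 * x')%N, (k - 2 - 2 * x').+1.
  by split; [lia | move=> i ik /=; repeat case: ifP; lia..].
(* The columns skipped by [g'] now lie to the right of the gap of [g], where the pivot of index i
   sits in column o + i + 2; hence the index is lower by 2. *)
exists (k - 4 - 2 * x')%N, (k - 4 - 2 * x').+1.
by split; [lia | move=> i ik /=; repeat case: ifP; lia..].
Qed.
End Pivots.

(** * From families of matrices to subspace codes *)

(** Distinct tagged matrices have distinct row spaces, as equal ones would meet in dimension [k].
    Hence the sizes of the families add up. *)
Lemma cdc_of_matrices (F : finFieldType) (n k : nat) (T : finType)
    (C : T -> {set 'M[F]_(k, n)}) :
  (2 <= k)%N ->
  (forall t M, M \in C t -> \dim (rowspace M) = k) ->
  (forall t s M N, M \in C t -> N \in C s -> (t, M) != (s, N) ->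
     (\dim (rowspace M :&: rowspace N) <= k - 2)%N) ->
  exists D : {set {vspace 'rV[F]_n}}, [/\ is_cdc 4 k D,
    #|D| = (\sum_t #|C t|)%N & forall t M, M \in C t -> rowspace M \in D].
Proof.
move=> k2 dimC capC; pose S := [set x : T * 'M[F]_(k, n) | x.2 \in C x.1].
have injS : {in S &, injective (fun x => rowspace x.2)}.
  move=> [t M] [s N]; rewrite !inE /= => MC NC e.
  apply/eqP/negPn/negP => /(capC _ _ _ _ MC NC).
  by rewrite e capvv (dimC _ _ NC); lia.
exists [set rowspace x.2 | x in S]; split.
- apply/andP; split.
    by apply/forall_inP => _ /imsetP[[t M] + ->]; rewrite inE /= => /dimC ->.
  apply/forall_inP => _ /imsetP[[t M] + ->]; rewrite inE /= => MC.
  apply/forall_inP => _ /imsetP[[s N] + ->]; rewrite inE /= => NC.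
  apply/implyP => MN; rewrite /subspace_dist (dimC _ _ MC) (dimC _ _ NC).
  have : (t, M) != (s, N) by apply: contra MN => /eqP[_ ->].
  by move=> /(capC _ _ _ _ MC NC); lia.
- rewrite card_in_imset // -sum1_card.
  rewrite (eq_bigl (fun x : T * 'M[F]_(k, n) => true && (x.2 \in C x.1)));
    last by move=> x; rewrite inE.
  rewrite -(pair_big_dep xpredT (fun t M => M \in C t) (fun _ _ => 1%N)) /=.
  by apply: eq_bigr => t _; rewrite sum1_card.
- by move=> t M MC; apply/imsetP; exists (t, M); rewrite ?inE.
Qed.

Lemma big_option (T : finType) (f : option T -> nat) :
  (\sum_t f t = f None + \sum_t f (Some t))%N.
Proof.
rewrite (bigD1 None) //=; congr (_ + _)%N.
rewrite (reindex_omap Some id) /=; last by case.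
by apply: eq_bigl => t; rewrite eqxx.
Qed.

(** * Matrices padded by an identity block *)

Section LiftAndPad.
Variables (F : finFieldType) (k : nat).

Definition pad_left m n (e : (m + k = n)%N) (A : 'M[F]_(k, m)) : 'M[F]_(k, n) :=
  castmx (erefl k, e) (row_mx A 1%:M).
Definition pad_right m n (e : (k + m = n)%N) (A : 'M[F]_(k, m)) : 'M[F]_(k, n) :=
  castmx (erefl k, e) (row_mx 1%:M A).

Lemma pad_left_pivoted m n (e : (m + k = n)%N) :
  exists p, forall A, pivoted p (pad_left e A).
Proof.
case: n / e; exists (@rshift m k) => A i l.
by rewrite /pad_left castmx_id row_mxEr mxE.
Qed.

Lemma pad_left_rank m n (e : (m + k = n)%N) A B :
  \rank (pad_left e A - pad_left e B) = \rank (A - B).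
Proof.
by case: n / e; rewrite /pad_left !castmx_id opp_row_mx add_row_mx subrr rank_row_mx0.
Qed.

Lemma pad_right_echelon m n (e : (k + m = n)%N) :
  exists p : 'I_k -> 'I_n, (forall i, p i = i :> nat) /\ forall A, echelon p (pad_right e A).
Proof.
case: n / e; exists (@lshift k m); split=> // A.
split=> [i l|i c ci]; rewrite /pad_right castmx_id; first by rewrite row_mxEl mxE.
have ck : (c < k)%N := ltn_trans ci (ltn_ord i).
rewrite (_ : c = lshift m (Ordinal ck)); last exact/val_inj.
by rewrite row_mxEl mxE -val_eqE /= gtn_eqF.
Qed.

Lemma pad_right_rank m n (e : (k + m = n)%N) A B :
  \rank (pad_right e A - pad_right e B) = \rank (A - B).
Proof.
by case: n / e; rewrite /pad_right !castmx_id opp_row_mx add_row_mx subrr rank_row_0mx.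
Qed.

Lemma pad_right_inj m n (e : (k + m = n)%N) : injective (pad_right e).
Proof.
by case: n / e => A B; rewrite /pad_right !castmx_id => /eq_row_mx[].
Qed.

Lemma pad_left_inj m n (e : (m + k = n)%N) : injective (pad_left e).
Proof.
by case: n / e => A B; rewrite /pad_left !castmx_id => /eq_row_mx[].
Qed.

Lemma conform_pad_right m n (e : (k + m = n)%N) (A : 'M[F]_(k, m)) :
  conform_mx (0 : 'M_(k, n)) (row_mx 1%:M A) = pad_right e A.
Proof. by case: n / e; rewrite conform_mx_id /pad_right castmx_id. Qed.
End LiftAndPad.

(** * The pieces of the code and their mutual intersections *)

Section Code.
Variables (F : finFieldType) (n k : nat).
Hypotheses (hk : (4 <= k)%N).

Definition is_piece (o : nat) (g : option (nat * nat)) (C : {set 'M[F]_(k, n)}) :=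
  [/\ (#|F| ^ code_exponent k (n - o - k) g <= #|C|)%N,
      exists p : 'I_k -> 'I_n, (forall i, p i = pivot k o g i :> nat) /\
        forall M, M \in C -> echelon p M &
      forall M N, M \in C -> N \in C -> M != N -> (2 <= \rank (M - N)%R)%N].

Lemma piece_exists o g : (o + k + k <= n)%N -> valid_shape k (n - o - k) g ->
  exists C, is_piece o g C.
Proof.
move=> okn vg.
have lt i : (i < k)%N -> (o <= pivot k o g i < n)%N.
  by move=> ik; apply: pivot_lt => //; lia.
pose p (i : 'I_k) : 'I_n := Ordinal (andP (lt i (ltn_ord i))).2.
have p_mono : {homo p : i l / (i < l)%N}.
  by move=> i l il; apply: (pivot_ltn (n := n)) => //; rewrite il /=.
have op i : (o <= p i)%N by case/andP: (lt i (ltn_ord i)).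
have [||C [cC eC dC]] := @echelon_code F n k p p_mono o op; [lia|lia|].
exists C; split=> //; last by exists p.
rewrite cC leq_exp2l ?finNzRing_gt1 //.
have := leq_trans (sum_pivot hk okn vg) (dots_geq p_mono); lia.
Qed.

(** This piece is built apart in order to exhibit its linear code. All [k * (n - k)] cells are free
    and one equation of degree [n - k] is imposed, leaving the MRD dimension for minimum rank 2, as
    [k <= n - k]. *)
Lemma lifted_piece (okn : (k + k <= n)%N) :
  exists C, is_piece 0 None C /\ exists D : {vspace 'M[F]_(k, n - k)},
    is_MRD 2 D /\ forall A, A \in D -> exists2 M, M \in C & rowspace M = lift_matrix A.
Proof.
have e : (k + (n - k) = n)%N by lia.
have [||||D [dimD DP]] := @rank_ge2_space F k (n - k) (n - k) setT setT; [lia|lia| | |].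
- by rewrite cardsT card_ord.
- by move=> x; rewrite inE.
rewrite cardsT card_prod !card_ord in dimD.
have dimD' : \dim D = ((k - 1) * (n - k))%N by rewrite dimD; nia.
exists [set pad_right e A | A in D]; split; [split|].
- rewrite card_imset ?card_vspace ?dimD' ?subn0 //; exact: pad_right_inj.
- have [p [pE pe]] := pad_right_echelon F e; exists p.
  by split=> // _ /imsetP[A _ ->].
- move=> _ _ /imsetP[A AD ->] /imsetP[B BD ->] AB.
  rewrite pad_right_rank; apply: (DP _ _).2; first exact: memvB.
  by rewrite subr_eq0; apply: contra AB => /eqP ->.
exists D; split.
  apply/andP; split; first by rewrite dimD'; apply/eqP; rewrite mulnC; congr (_ * _)%N; lia.
  by apply/forall_inP => A AD; apply/implyP; apply: (DP A AD).2.
move=> A AD; exists (pad_right e A); first exact: imset_f.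
by rewrite /lift_matrix conform_pad_right.
Qed.

Lemma dim_cap_pieces o o' g g' C C' M N :
  is_piece o g C -> is_piece o' g' C' -> M \in C -> N \in C' ->
  separated k (pivot k o g) (pivot k o' g') ->
  (\dim (rowspace M :&: rowspace N) <= k - 2)%N.
Proof.
move=> [_ [p [pE pe]] _] [_ [q [qE qe]] _] MC NC [i1 [i2 [i12 q1 q2]]].
have i1k : (i1 < k)%N by lia.
have i2k : (i2 < k)%N by lia.
apply: (@dim_cap_echelon _ _ _ p q M N (Ordinal i1k) (Ordinal i2k)).
- exact: pe.
- exact: qe.
- by apply/eqP => /(congr1 val) /=; lia.
- by move=> i; apply/eqP => /(congr1 val) /=; rewrite pE qE; apply: q1.
- by move=> i; apply/eqP => /(congr1 val) /=; rewrite pE qE; apply: q2.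
Qed.

Lemma dim_cap_piece o g C M N : is_piece o g C -> M \in C -> N \in C -> M != N ->
  (\dim (rowspace M :&: rowspace N) <= k - 2)%N.
Proof.
move=> [_ [p [_ pe]] rk] MC NC MN.
apply: leq_trans (dim_cap_same_pivots (pe _ MC).1 (pe _ NC).1) _.
by apply: leq_sub2l; apply: rk.
Qed.

Lemma dim_cap_piece_pad_left o g C M (e : (n - k + k = n)%N) A :
  is_piece o g C -> M \in C -> (o + k <= n - k - 2)%N -> (\rank A <= k - 4)%N ->
  valid_shape k (n - o - k) g ->
  (\dim (rowspace M :&: rowspace (pad_left e A)) <= k - 2)%N.
Proof.
move=> [_ [p [pE pe]] _] MC okn rA vg.
have cp : (#|[set i | n - k <= p i]| <= 2)%N.
  (* A pivot of index below [k - 2] stays inside its block, hence to the left of column [n - k]. *)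
  have sub : [set i | n - k <= p i]%N \subset [set i : 'I_k | k - 2 <= i]%N.
    apply/subsetP => i; rewrite !inE pE; have := ltn_ord i.
    by case: g vg {pE} => [[x y]|] /=; repeat case: ifP; lia.
  apply: leq_trans (subset_leq_card sub) _; rewrite card_ord_geq; lia.
apply: leq_trans (dim_cap_echelon_right e A (pe _ MC) cp) _; lia.
Qed.
End Code.

(** Multiplying by [a ^+ 4 - 1] telescopes the sum to a^(2h) - a^e, where e is 2 for odd [h] and 0
    for even [h]. The left side takes e = 2 throughout, so it is attained exactly for odd [h]. *)
Lemma geometric_bound (R : numFieldType) (a : R) (h : nat) : 1 < a -> (1 <= h)%N ->
  a ^+ 2 * ((a ^+ (2 * (h - 1)) - 1) / (a ^+ 4 - 1))
    <= \sum_(i < h %/ 2) a ^+ (2 * (h - 2) - 4 * i).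
Proof.
move=> a1 h1; have a0 : 0 < a := lt_trans ltr01 a1.
have a41 : 0 < a ^+ 4 - 1 by rewrite subr_gt0 exprn_egt1.
have sumE l : (2 * l <= h)%N ->
    (\sum_(i < l) a ^+ (2 * (h - 2) - 4 * i)) * (a ^+ 4 - 1) = a ^+ (2 * h) - a ^+ (2 * h - 4 * l).
  elim: l => [|l IH] lh; first by rewrite big_ord0 mul0r muln0 subn0 subrr.
  rewrite big_ord_recr /= mulrDl IH; last by lia.
  have -> : (2 * h - 4 * l = 2 * (h - 2) - 4 * l + 4)%N by lia.
  have -> : (2 * h - 4 * l.+1 = 2 * (h - 2) - 4 * l)%N by lia.
  by rewrite exprD; ring.
rewrite mulrA ler_pdivrMr // sumE; last by lia.
rewrite mulrBr mulr1 -exprD (_ : (2 + 2 * (h - 1) = 2 * h)%N); last by lia.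
rewrite lerD2l lerN2 ler_eXn2l //; lia.
Qed.

(** * Assembling the code *)

Section Assembly.
Variables (F : finFieldType) (n k : nat).
Hypotheses (hn : (2 * k + 2 <= n)%N) (hk : (4 <= k)%N).

Local Notation blocks := ((n - 2) %/ k).-1%N.
(** The range of [y] depends on the block, so one index type ['I_n] serves all blocks and
    [valid_shape] selects the admissible values. *)
Local Notation shape := (option ('I_((k - 1) %/ 2) * 'I_n)).

Definition shape_val (g : shape) : option (nat * nat) :=
  omap (fun xy => (val xy.1, val xy.2)) g.

(** From [j + 2 <= (n - 2) %/ k] follows (j + 2) k <= n - 2: the block ends before the last [k + 2]
    columns. *)
Lemma block_bound (j : 'I_blocks) : (j * k + k <= n - k - 2)%N.
Proof.
move: (nat_of_ord j) (ltn_ord j) (leq_trunc_div (n - 2) k) => i.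
move: ((n - 2) %/ k)%N => N iN Nk.
have : ((i + 2) * k <= N * k)%N by rewrite leq_mul2r; apply/orP; right; lia.
lia.
Qed.

Lemma blocks_gt0 : (0 < blocks)%N.
Proof.
have : (2 <= (n - 2) %/ k)%N by rewrite leq_divRL; lia.
lia.
Qed.

Lemma shape_val_inj : injective shape_val.
Proof. by move=> [[x y]|] [[x' y']|] //= [/val_inj -> /val_inj ->]. Qed.

Lemma Abar_lower_bound :
  (AR F k (n - k) 2 [pred r : nat | (0 <= r <= k - 4)%N] +
   \sum_(j < blocks) \sum_(g : shape | valid_shape k (n - j * k - k) (shape_val g))
     #|F| ^ code_exponent k (n - j * k - k) (shape_val g) <= Abar F n 2 k)%N.
Proof.
have e : (n - k + k = n)%N by lia.
pose j0 := Ordinal blocks_gt0.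
pose T0 := ('I_blocks * shape)%type.
pose valid (t : T0) := valid_shape k (n - t.1 * k - k) (shape_val t.2).
(* Each tag chooses one piece; invalid shapes get the empty set, and the leftmost consecutive
   pattern gets the lifted MRD code. *)
have /fin_all_exists[C hC] : forall t : T0, exists C : {set 'M[F]_(k, n)},
    [/\ valid t -> is_piece (t.1 * k) (shape_val t.2) C, ~~ valid t -> C = set0 &
     t = (j0, None) -> exists D : {vspace 'M[F]_(k, n - k)}, is_MRD 2 D /\
       forall A, A \in D -> exists2 M, M \in C & rowspace M = lift_matrix A].
  move=> t; have [->|t0] := eqVneq t (j0, None).
    have [|C [pC DC]] := @lifted_piece F n k hk; first by lia.
    by exists C; split.
  have [vt|vt] := boolP (valid t); last by exists set0; split=> // e0; case/eqP: t0.
  have [|C pC] := @piece_exists F n k hk (t.1 * k) (shape_val t.2) _ vt.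
    by have := block_bound t.1; lia.
  by exists C; split=> // e0; case/eqP: t0.
have validC t M : M \in C t -> valid t.
  by have [_ C0 _] := hC t; apply: contraTT => /C0 ->; rewrite inE.
have pieceC t M : M \in C t -> is_piece (t.1 * k) (shape_val t.2) (C t).
  by move/validC; have [pC _ _] := hC t.
have [|B] := @eq_bigmax_cond _ (fun C : {set 'M[F]_(k, n - k)} =>
         [forall A in C, \rank A \in [pred r : nat | (0 <= r <= k - 4)%N]] &&
         [forall A in C, forall B in C,
            (A != B) ==> (2 <= rank_dist A B)%N]) (fun C => #|C|).
  (* The maximum is attained because the empty code is admissible. *)
  apply/card_gt0P; exists set0; rewrite unfold_in.
  by apply/andP; split; apply/forall_inP => A; rewrite inE.
rewrite unfold_in => /andP[/forall_inP rB /forall_inP dB].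
rewrite -/(AR F k (n - k) 2 [pred r : nat | (0 <= r <= k - 4)%N]) => AR_B.
(* The extra tag [None] carries the matrices (A | I) with [A] in an optimal rank-restricted code. *)
pose CC (t : option T0) := if t is Some t then C t else [set pad_left e A | A in B].
have [pB pBE] := pad_left_pivoted F e.
have capP t s M N : M \in C t -> N \in C s -> (t, M) != (s, N) ->
    (\dim (rowspace M :&: rowspace N) <= k - 2)%N.
  move: t s => [i g] [j h] MC NC neq.
  have [ij|ij|/val_inj eij] := ltngtP i j.
  - apply: (dim_cap_pieces hk (pieceC _ _ MC) (pieceC _ _ NC)) => //.
    apply: (pivot_separated_block hk _ _ (validC _ _ MC)) => /=.
    by rewrite -mulSnr leq_mul2r ij orbT.
  - rewrite capvC; apply: (dim_cap_pieces hk (pieceC _ _ NC) (pieceC _ _ MC)) => //.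
    apply: (pivot_separated_block hk _ _ (validC _ _ NC)) => /=.
    by rewrite -mulSnr leq_mul2r ij orbT.
  subst j; have [egh|gh] := eqVneq g h.
    subst h; apply: (dim_cap_piece (pieceC _ _ MC)) => //.
    by apply: contra neq => /eqP ->.
  have [|sep|sep] := @pivot_separated_shape k hk (i * k) _ _ _ _ (validC _ _ MC) (validC _ _ NC).
  - by move=> /shape_val_inj /eqP; rewrite (negPf gh).
  - exact: (dim_cap_pieces hk (pieceC _ _ MC) (pieceC _ _ NC)).
  - by rewrite capvC; apply: (dim_cap_pieces hk (pieceC _ _ NC) (pieceC _ _ MC)).
have capPB t M A : M \in C t -> A \in B ->
    (\dim (rowspace M :&: rowspace (pad_left e A)) <= k - 2)%N.
  move=> MC AB; apply: (dim_cap_piece_pad_left hk e (pieceC _ _ MC)) => //.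
  - exact: block_bound.
  - by have := rB A AB; rewrite inE.
  - exact: validC MC.
have [|||D [cdcD cardD CD]] := @cdc_of_matrices F n k _ CC; first by lia.
- move=> [t|] M /=; last by case/imsetP => A _ ->; apply: dim_rowspace (pBE A).
  by move=> MC; have [_ [p [_ pM]] _] := pieceC _ _ MC; apply: dim_rowspace (pM M MC).1.
- move=> [t|] [s|] M N /=.
  + by move=> MC NC ne; apply: capP MC NC _; apply: contra ne => /eqP[-> ->].
  + by move=> MC /imsetP[A AB ->] _; apply: capPB MC AB.
  + by move=> /imsetP[A AB ->] NC _; rewrite capvC; apply: capPB NC AB.
  + move=> /imsetP[A1 A1B ->] /imsetP[A2 A2B ->] ne.
    apply: leq_trans (dim_cap_same_pivots (pBE A1) (pBE A2)) _.
    rewrite leq_sub2l // pad_left_rank; have /forall_inP := dB _ A1B.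
    by move=> /(_ _ A2B)/implyP; apply; apply: contra ne => /eqP ->.
have cD : (#|D| <= Abar F n 2 k)%N.
  rewrite /Abar; apply: (leq_bigmax_cond (F := fun C : {set {vspace 'rV[F]_n}} => #|C|)).
  rewrite cdcD /=; have [_ _ /(_ erefl)[D0 [MRD0 liftD0]]] := hC (j0, None).
  apply/existsP; exists D0; rewrite MRD0 /=; apply/subsetP => _ /imsetP[A /liftD0[M MC <-] ->].
  exact: (CD (Some (j0, None))).
apply: leq_trans cD; rewrite cardD big_option /=.
rewrite card_imset ?AR_B ?leq_add2l; last exact: pad_left_inj.
(* The invalid tags are split off and bounded below by zero. *)
rewrite pair_big_dep /= [leqRHS](bigID valid) /= -[leqLHS]addn0 leq_add //.
by apply: leq_sum => t vt; have [/(_ vt)[]] := hC t.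
Qed.

End Assembly.

(** * Comparison with the closed formula *)

Lemma sum_valid_shapes (a k m n : nat) : (m <= n)%N ->
  (\sum_(g : option ('I_((k - 1) %/ 2) * 'I_n) | valid_shape k m (shape_val g))
      a ^ code_exponent k m (shape_val g) =
   a ^ ((k - 1) * m) + \sum_(x < (k - 1) %/ 2) \sum_(y < m %/ 2)
     a ^ ((k - 3) * (m - 2) + (2 * (k - 3) - 4 * x) + (2 * (m - 2) - 4 * y)))%N.
Proof.
move=> mn; rewrite big_mkcond big_option /=; congr (_ + _)%N.
rewrite -(pair_bigA _ (fun (x : 'I_((k - 1) %/ 2)) (y : 'I_n) =>
  if (x < (k - 1) %/ 2)%N && (y < m %/ 2)%N then
    a ^ ((k - 3) * (m - 2) + (2 * (k - 3) - 4 * x) + (2 * (m - 2) - 4 * y)) else 0)%N) /=.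
apply: eq_bigr => x _; rewrite ltn_ord /= -big_mkcond /=.
rewrite (big_ord_widen n (fun y =>
  a ^ ((k - 3) * (m - 2) + (2 * (k - 3) - 4 * x) + (2 * (m - 2) - 4 * y)))%N) //.
exact: leq_trans (leq_div _ _) mn.
Qed.

Theorem theorem3p14 (q : nat) (F : finFieldType) (hF : #|F| = q) (n k : nat)
    (hn : (2 * k + 2 <= n)%N) (hk : (4 <= k)%N) :
  \sum_(1 <= j < (n - 2) %/ k)
     (q%:R ^+ ((k - 1) * (n - j * k))
      + ((q%:R ^+ (2 * (k - 2)) - 1) * (q%:R ^+ (2 * (n - j * k - 1)) - 1))
          / (q%:R ^+ 4 - 1) ^+ 2
        * q%:R ^+ ((k - 3) * (n - j * k - 2) + 4))
   + (AR F k (n - k) 2 [pred r : nat | (0 <= r <= k - 4)%N])%:R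
  <= (Abar F n 2 k)%:R :> rat.
Proof.
have := Abar_lower_bound F hn hk; rewrite hF -(ler_nat rat); apply: le_trans.
rewrite natrD addrC lerD2l natr_sum.
(* Block [j], counted from 0, gives the summand of index [j + 1]. *)
rewrite (big_addn 0 _ 1) subn1 big_mkord; apply: ler_sum => j _.
have jb := block_bound hn hk j; rewrite addn1 mulSnr.
set m := (n - (j * k + k))%N; rewrite -subnDA -/m.
have q1 : 1 < q%:R :> rat by rewrite ltr1n -hF finNzRing_gt1.
rewrite sum_valid_shapes ?leq_subr // natrD natrX lerD2l.
(* The exponent splits into a constant, a term in [x] and a term in [y], so the double sum
   factors. *)
have -> : ((\sum_(x < (k - 1) %/ 2) \sum_(y < m %/ 2)
      q ^ ((k - 3) * (m - 2) + (2 * (k - 3) - 4 * x) + (2 * (m - 2) - 4 * y)))%N%:R : rat) =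
    q%:R ^+ ((k - 3) * (m - 2)) * ((\sum_(x < (k - 1) %/ 2) q%:R ^+ (2 * (k - 3) - 4 * x)) *
      (\sum_(y < m %/ 2) q%:R ^+ (2 * (m - 2) - 4 * y))).
  rewrite natr_sum mulr_suml mulr_sumr; apply: eq_bigr => x _.
  rewrite natr_sum mulr_sumr mulr_sumr; apply: eq_bigr => y _.
  by rewrite natrX !exprD mulrA.
(* The geometric bound is used with [h = k - 1] for the gaps and with [h = m] for the last pivots.
   The two prefactors q^2 account for the [+ 4] in the final exponent. *)
have gk : q%:R ^+ 2 * ((q%:R ^+ (2 * (k - 2)) - 1) / (q%:R ^+ 4 - 1))
    <= \sum_(x < (k - 1) %/ 2) q%:R ^+ (2 * (k - 3) - 4 * x) :> rat.
  by have := @geometric_bound rat q%:R (k - 1) q1; rewrite -!subnDA; apply; lia.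
have gm : q%:R ^+ 2 * ((q%:R ^+ (2 * (m - 1)) - 1) / (q%:R ^+ 4 - 1))
    <= \sum_(y < m %/ 2) q%:R ^+ (2 * (m - 2) - 4 * y) :> rat.
  by apply: geometric_bound; rewrite // /m; lia.
have ge0 e : 0 <= q%:R ^+ 2 * ((q%:R ^+ e - 1) / (q%:R ^+ 4 - 1)) :> rat.
  by rewrite mulr_ge0 ?exprn_ge0 ?divr_ge0 ?subr_ge0 ?exprn_ege1 // ltW.
have := ler_pM (ge0 _) (ge0 _) gk gm.
move/(ler_wpM2l (exprn_ge0 ((k - 3) * (m - 2)) (ler0n rat q))); apply: le_trans.
rewrite le_eqVlt; apply/orP; left; apply/eqP.
rewrite [q%:R ^+ (_ + 4)]exprD.
have : q%:R ^+ 4 - 1 != 0 :> rat by rewrite gt_eqF // subr_gt0 exprn_egt1.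
by move=> ?; field.
Qed.
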